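(* Let $m,n\ge 1$, $A\in\mathbb{Z}^{m\times n}$, $b\in\mathbb{Z}^m$, $c\in\mathbb{R}^n$ and $F=F^T\in\mathbb{R}^{n\times n}$, and let $$f^*=\min\{\,c^Tx+x^TFx:\ Ax=b;\ x\in\{-1,1\}^n\,\}.$$ Let $\rho(c,F)$ be the scalar defined in the context, let $Q:\mathbb{R}^{n+1}\to\mathbb{R}$ be the quadratic form $$Q(x,x_0)=x_0\,c^Tx+x^TFx+(2\rho(c,F)+1)\,\Vert Ax-x_0\,b\Vert^2,\qquad x\in\mathbb{R}^n,\ x_0\in\mathbb{R},$$ and let $$\theta:=\min_{(x,x_0)\in\{-1,1\}^{n+1}}Q(x,x_0).$$ If $f^*<+\infty$ then $f^*=\theta$; that is, $f^*$ is the optimal value of the MAX-CUT problem associated with the quadratic form $Q$ (the minimization of $Q$ over $\{-1,1\}^{n+1}$). Moreover, $f^*=+\infty$ if and only if $\theta>\rho(c,F)$.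
   Context: $\Vert\cdot\Vert$ is the Euclidean norm, and $f^*=+\infty$ by convention when $\{x\in\{-1,1\}^n: Ax=b\}=\emptyset$. For symmetric matrices, $\langle X,F\rangle=\mathrm{trace}(XF)$ and $M\succeq0$ means $M$ is positive semidefinite. The ''MAX-CUT problem associated with a quadratic form'' means the problem of minimizing that form over the hypercube vertices $\{-1,1\}^{n+1}$. For $c\in\mathbb{R}^n$ and symmetric $F\in\mathbb{R}^{n\times n}$ define $$r^1_{c,F}=\min\Big\{c^Tx+\langle X,F\rangle:\ \begin{bmatrix}1&x^T\\ x&X\end{bmatrix}\succeq0,\ X_{ii}=1,\ i=1,\ldots,n\Big\},$$ $$r^2_{c,F}=\max\Big\{c^Tx+\langle X,F\rangle:\ \begin{bmatrix}1&x^T\\ x&X\end{bmatrix}\succeq0,\ X_{ii}=1,\ i=1,\ldots,n\Big\},$$ where the optimization is over $x\in\mathbb{R}^n$ and symmetric $X\in\mathbb{R}^{n\times n}$, and set $$\rho(c,F):=\max_{i=1,2}|r^i_{c,F}|.$$ *)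

(* Defs.v *)
From HB Require Import structures.
From mathcomp Require Import all_boot all_order all_algebra.
From mathcomp Require Import all_classical all_reals all_analysis.
From mathcomp Require Import ring lra.

Set Implicit Arguments.
Unset Strict Implicit.
Unset Printing Implicit Defensive.

Import Order.TTheory GRing.Theory Num.Theory.
Import numFieldNormedType.Exports.

Local Open Scope classical_set_scope.
Local Open Scope ring_scope.

Definition dot (R : realType) (n : nat) (c x : 'cV[R]_n) : R :=
  (c^T *m x) 0 0.

Definition qform (R : realType) (n : nat) (F : 'M[R]_n) (x : 'cV[R]_n) : R :=
  (x^T *m F *m x) 0 0.

(* The library norm `|x| on matrices is the sup norm, hence this definition. *)
Definition enorm (R : realType) (n : nat) (x : 'cV[R]_n) : R :=
  Num.sqrt (\sum_i x i 0 ^+ 2).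

Definition psd (R : realType) (n : nat) (M : 'M[R]_n) : Prop :=
  M^T = M /\ forall v : 'cV[R]_n, 0 <= qform M v.

Definition hypercube (R : realType) (n : nat) : set 'cV[R]_n :=
  [set x | forall i, x i 0 = 1 \/ x i 0 = -1].
Arguments hypercube R n : clear implicits.

Definition sdp_feasible (R : realType) (n : nat) : set ('cV[R]_n * 'M[R]_n) :=
  [set p | [/\ p.2^T = p.2,
               psd (block_mx (1%:M : 'M[R]_1) p.1^T p.1 p.2)
             & forall i, p.2 i i = 1]].
Arguments sdp_feasible R n : clear implicits.

Definition sdp_obj (R : realType) (n : nat) (c : 'cV[R]_n) (F : 'M[R]_n)
    (p : 'cV[R]_n * 'M[R]_n) : R :=
  dot c p.1 + \tr (p.2 *m F).

(* inf and sup are attained, see sdp_min_attained and sdp_max_attained. *)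
Definition sdp_min (R : realType) (n : nat) (c : 'cV[R]_n) (F : 'M[R]_n) : R :=
  inf (sdp_obj c F @` sdp_feasible R n).

Definition sdp_max (R : realType) (n : nat) (c : 'cV[R]_n) (F : 'M[R]_n) : R :=
  sup (sdp_obj c F @` sdp_feasible R n).

Definition rho (R : realType) (n : nat) (c : 'cV[R]_n) (F : 'M[R]_n) : R :=
  Num.max `|sdp_min c F| `|sdp_max c F|.

Definition feasible (R : realType) (m n : nat) (A : 'M[int]_(m, n))
    (b : 'cV[int]_m) : set 'cV[R]_n :=
  [set x | map_mx intr A *m x = map_mx intr b /\ hypercube R n x].
Arguments feasible R {m n} A b.

(* ereal_inf set0 = +oo is the convention for infeasible problems; otherwise
   the infimum is attained, see fstar_attained. *)
Definition fstar (R : realType) (m n : nat) (A : 'M[int]_(m, n))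
    (b : 'cV[int]_m) (c : 'cV[R]_n) (F : 'M[R]_n) : \bar R :=
  ereal_inf [set (dot c x + qform F x)%:E | x in feasible R A b].

(* A point (x, x0) of R^(n+1) is the column vector y with upper block x and
   last coordinate x0. *)
Definition penalized_form (R : realType) (m n : nat) (A : 'M[int]_(m, n))
    (b : 'cV[int]_m) (c : 'cV[R]_n) (F : 'M[R]_n) (y : 'cV[R]_(n + 1)) : R :=
  let x := usubmx y in let x0 := dsubmx y 0 0 in
  x0 * dot c x + qform F x +
  (2 * rho c F + 1) * enorm (map_mx intr A *m x - x0 *: map_mx intr b) ^+ 2.

(* The infimum is over a nonempty finite set, see maxcut_value_attained. *)
Definition maxcut_value (R : realType) (N : nat) (q : 'cV[R]_N -> R) : R :=
  inf (q @` hypercube R N).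

Lemma hypercube_argmin (R : realType) (n : nat) (P : set 'cV[R]_n)
    (f : 'cV[R]_n -> R) :
  P `<=` hypercube R n -> P !=set0 ->
  exists2 x, P x & forall y, P y -> f x <= f y.
Proof.
move=> PH [x0 Px0].
pose vec (s : {ffun 'I_n -> bool}) : 'cV[R]_n :=
  \col_i (if s i then 1 else -1).
have vecP y : hypercube R n y -> exists s, y = vec s.
  move=> Hy; exists [ffun i => y i 0 == 1]; apply/matrixP=> i j.
  rewrite !mxE ffunE ord1; case: eqP => // ne.
  by case: (Hy i).
have [s0 es0] := vecP _ (PH _ Px0).
have Ps0 : `[< P (vec s0) >] by apply/asboolP; rewrite -es0.
pose g s := f (vec s).
have [s /asboolP Ps smin] :=
  @arg_minP _ _ _ s0 (fun s => `[< P (vec s) >]) g Ps0.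
exists (vec s) => // y Py; have [t et] := vecP _ (PH _ Py).
by rewrite et; apply: smin; apply/asboolP; rewrite -et.
Qed.

Lemma hypercube_nonempty (R : realType) (n : nat) : hypercube R n !=set0.
Proof. by exists (const_mx 1) => i; rewrite mxE; left. Qed.

Lemma inf_min (R : realType) (T : Type) (S : set T) (f : T -> R) (x : T) :
  S x -> (forall y, S y -> f x <= f y) -> inf (f @` S) = f x.
Proof.
move=> Sx fx; apply/eqP; rewrite eq_le; apply/andP; split.
  apply: ge_inf; last by exists x.
  by exists (f x) => _ [y Sy <-]; apply: fx.
apply: lb_le_inf; first by exists (f x), x.
by move=> _ [y Sy <-]; apply: fx.
Qed.

Lemma sup_max (R : realType) (T : Type) (S : set T) (f : T -> R) (x : T) :
  S x -> (forall y, S y -> f y <= f x) -> sup (f @` S) = f x.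
Proof.
move=> Sx fx; apply/eqP; rewrite eq_le; apply/andP; split.
  apply: ge_sup; first by exists (f x), x.
  by move=> _ [y Sy <-]; apply: fx.
apply: ub_le_sup; last by exists x.
by exists (f x) => _ [y Sy <-]; apply: fx.
Qed.

Lemma maxcut_value_attained (R : realType) (N : nat) (q : 'cV[R]_N -> R) :
  exists2 x, hypercube R N x &
    maxcut_value q = q x /\ forall y, hypercube R N y -> q x <= q y.
Proof.
have [x Hx xm] := @hypercube_argmin R N _ q (fun _ h => h)
  (@hypercube_nonempty R N).
by exists x => //; split=> //; apply: inf_min.
Qed.

Lemma fstar_attained (R : realType) (m n : nat) (A : 'M[int]_(m, n))
    (b : 'cV[int]_m) (c : 'cV[R]_n) (F : 'M[R]_n) :
  feasible R A b !=set0 ->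
  exists2 x, feasible R A b x &
    fstar A b c F = (dot c x + qform F x)%:E /\
    forall y, feasible R A b y ->
      dot c x + qform F x <= dot c y + qform F y.
Proof.
move=> ne; pose f (x : 'cV[R]_n) := dot c x + qform F x.
have [x Px xm] := @hypercube_argmin R n (feasible R A b) f
  (fun _ => @proj2 _ _) ne.
exists x => //; split=> //; apply/eqP; rewrite eq_le; apply/andP; split.
  by apply: ereal_inf_lbound; exists x.
by apply: le_ereal_inf_tmp => _ [y Py <-]; rewrite lee_fin; apply: xm.
Qed.

Lemma psd_entry_le1 (R : realType) (n : nat) (M : 'M[R]_n) :
  psd M -> (forall i, M i i = 1) -> forall i j, `|M i j| <= 1.
Proof.
move=> [Ms Mp] Md i j.
have qE (s : R) : qform M (delta_mx i 0 + s *: delta_mx j 0) =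
    1 + s ^+ 2 + 2 * s * M i j.
  have dE (k l : 'I_n) : (delta_mx k 0 : 'cV[R]_n)^T *m M *m
      (delta_mx l 0 : 'cV[R]_n) = (M k l)%:M.
    rewrite trmx_delta -rowE -colE; apply/matrixP=> u v.
    by rewrite !ord1 !mxE eqxx mulr1n.
  have sym : M j i = M i j by rewrite -{1}Ms mxE.
  have tE (u v : 'cV[R]_n) : (u + s *: v)^T = u^T + s *: v^T.
    by apply/matrixP=> k l; rewrite !mxE.
  rewrite /qform tE !mulmxDl !mulmxDr.
  rewrite -?scalemxAl -?scalemxAr -?scalemxAl.
  rewrite !dE. rewrite !mxE /= !mulr1n !Md sym.
  by ring.
have := Mp (delta_mx i 0 + 1 *: delta_mx j 0).
have := Mp (delta_mx i 0 + (-1) *: delta_mx j 0).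
rewrite !qE => h1 h2; rewrite ler_norml; apply/andP; split; lra.
Qed.

Lemma sdp_feasible_nonempty (R : realType) (n : nat) :
  sdp_feasible R n !=set0.
Proof.
exists (0, 1%:M); split=> /=; first by rewrite trmx1.
  rewrite trmx0 -scalar_mx_block; split; first by rewrite trmx1.
  move=> v; rewrite /qform mulmx1 mxE; apply: sumr_ge0 => i _.
  by rewrite mxE -expr2 sqr_ge0.
by move=> i; rewrite mxE eqxx.
Qed.

Definition sdp_point (R : realType) (n : nat) (v : 'rV[R]_(n + n * n)) :
    'cV[R]_n * 'M[R]_n :=
  ((lsubmx v)^T, vec_mx (rsubmx v)).

Lemma sdp_pointK (R : realType) (n : nat) (p : 'cV[R]_n * 'M[R]_n) :
  sdp_point (row_mx p.1^T (mxvec p.2)) = p.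
Proof. by case: p => x X; rewrite /sdp_point row_mxKl row_mxKr trmxK mxvecK. Qed.

Lemma sdp_point_continuous (R : realType) (n : nat) :
  (forall i j, continuous (fun v : 'rV[R]_(n + n * n) => (sdp_point v).1 i j)) /\
  (forall i j, continuous (fun v : 'rV[R]_(n + n * n) => (sdp_point v).2 i j)).
Proof.
split=> i j v.
  rewrite /sdp_point /=.
  under eq_fun do rewrite !mxE.
  exact: coord_continuous.
rewrite /sdp_point /=.
under eq_fun do rewrite !mxE.
exact: coord_continuous.
Qed.

Lemma sum_continuous (R : realType) (T : topologicalType) (I : finType)
    (f : I -> T -> R) :
  (forall i, continuous (f i)) -> continuous (fun v => \sum_i f i v).
Proof.
move=> fc; apply: continuous_big => [|i _]; first exact: add_continuous.
exact: fc.
Qed.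

Lemma sdp_obj_continuous (R : realType) (n : nat) (c : 'cV[R]_n)
    (F : 'M[R]_n) :
  continuous (fun v => sdp_obj c F (sdp_point v)).
Proof.
have [c1 c2] := sdp_point_continuous R n.
have -> : (fun v => sdp_obj c F (sdp_point v)) = (fun v =>
    \sum_i c i 0 * (sdp_point v).1 i 0 +
    \sum_i \sum_j (sdp_point v).2 i j * F j i).
  apply/funext => v; rewrite /sdp_obj /dot /mxtrace; congr (_ + _).
    by rewrite mxE; apply: eq_bigr => i _; rewrite !mxE.
  by apply: eq_bigr => i _; rewrite mxE.
move=> v; apply: (@continuousD R R^o).
  apply: (@sum_continuous R _ _ (fun i v => c i 0 * (sdp_point v).1 i 0)) => i w.
  by apply: continuousM; [exact: cst_continuous | exact: c1].
apply: (@sum_continuous R _ _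
  (fun i v => \sum_j (sdp_point v).2 i j * F j i)) => i.
apply: (@sum_continuous R _ _ (fun j v => (sdp_point v).2 i j * F j i)) => j w.
by apply: continuousM; [exact: c2 | exact: cst_continuous].
Qed.

Lemma sdp_block_continuous (R : realType) (n : nat) (i j : 'I_(1 + n)) :
  continuous (fun v : 'rV[R]_(n + n * n) =>
    block_mx (1%:M : 'M[R]_1) (sdp_point v).1^T (sdp_point v).1 (sdp_point v).2
      i j).
Proof.
have [c1 c2] := sdp_point_continuous R n.
move=> v; case: (split_ordP i) => i' ->; case: (split_ordP j) => j' ->.
- by under eq_fun do rewrite block_mxEul; exact: cst_continuous.
- by under eq_fun do rewrite block_mxEur mxE; exact: c1.
- by under eq_fun do rewrite block_mxEdl; exact: c1.
- by under eq_fun do rewrite block_mxEdr; exact: c2.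
Qed.

Lemma sdp_feasible_closed (R : realType) (n : nat) :
  closed (@sdp_point R n @^-1` sdp_feasible R n).
Proof.
have [c1 c2] := sdp_point_continuous R n.
have cl (T : topologicalType) (f : T -> R) (B : set R) : continuous f ->
    closed B -> closed (f @^-1` B).
  by move=> fc Bc; apply: closed_comp => // x _; exact: fc.
have bc := @sdp_block_continuous R n.
pose blk v := block_mx (1%:M : 'M[R]_1) (@sdp_point R n v).1^T
  (sdp_point v).1 (sdp_point v).2.
have -> : @sdp_point R n @^-1` sdp_feasible R n =
   (\bigcap_(ij : 'I_n * 'I_n) [set v |
       (sdp_point v).2 ij.2 ij.1 - (sdp_point v).2 ij.1 ij.2 = 0]) `&`
   ((\bigcap_(u : 'cV[R]_(1 + n)) [set v | 0 <= qform (blk v) u]) `&`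
    (\bigcap_(i : 'I_n) [set v | (sdp_point v).2 i i = 1])).
  apply/seteqP; split=> v /=.
    move=> [sX [_ P] d]; split; first move=> [i j] _ /=.
      by have /matrixP/(_ i j) := sX; rewrite mxE => ->; rewrite subrr.
    by split=> [u _|i _] /=; [exact: P | exact: d].
  move=> [sX [P d]]; have sX' : (sdp_point v).2^T = (sdp_point v).2.
    by apply/matrixP=> i j; rewrite mxE; apply/eqP; rewrite -subr_eq0;
       apply/eqP; exact: (sX (i, j) I).
  split=> //=; last by move=> i; exact: d.
  split; last by move=> u; exact: P.
  by rewrite tr_block_mx trmx1 trmxK sX'.
apply: closedI; last apply: closedI.
- apply: closed_bigI => -[i j] _ /=.
  apply: (@cl _ (fun v => (sdp_point v).2 j i - (sdp_point v).2 i j)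
    [set x | x = 0]); last exact: closed_eq.
  by move=> v; apply: (@continuousB R R^o); exact: c2.
- apply: closed_bigI => u _ /=.
  apply: (@cl _ (fun v => qform (blk v) u) [set x | 0 <= x]);
    last exact: closed_ge.
  have -> : (fun v => qform (blk v) u) =
     (fun v => \sum_i \sum_j (u j 0 * blk v j i * u i 0)).
    apply/funext => v; rewrite /qform mxE; apply: eq_bigr => i _.
    by rewrite !mxE mulr_suml; apply: eq_bigr => j _; rewrite !mxE.
  apply: (@sum_continuous R _ _
    (fun i v => \sum_j (u j 0 * blk v j i * u i 0))) => i.
  apply: (@sum_continuous R _ _ (fun j v => u j 0 * blk v j i * u i 0)) => j w.
  apply: (@continuousM R _ (fun v => u j 0 * blk v j i) (fun=> u i 0));
    last exact: cst_continuous.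
  apply: (@continuousM R _ (fun=> u j 0) (fun v => blk v j i));
    [exact: cst_continuous | exact: bc].
- apply: closed_bigI => i _ /=.
  by apply: (@cl _ (fun v => (sdp_point v).2 i i) [set x | x = 1]);
    [exact: c2 | exact: closed_eq].
Qed.

Lemma sdp_feasible_compact (R : realType) (n : nat) :
  compact (@sdp_point R n @^-1` sdp_feasible R n).
Proof.
have box : compact [set v : 'rV[R]_(n + n * n) |
    forall i, `[(-1 : R), 1]%classic (v ord0 i)].
  by apply: (@rV_compact R _ (fun=> `[(-1 : R), 1]%classic)) => i;
    exact: segment_compact.
apply: (subclosed_compact _ box); first exact: sdp_feasible_closed.
move=> v [sX P d] k /=; rewrite in_itv /= -ler_norml.
have D i : block_mx (1%:M : 'M[R]_1) (sdp_point v).1^T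
    (sdp_point v).1 (sdp_point v).2 i i = 1.
  case: (split_ordP i) => i' ->; first by rewrite block_mxEul !ord1 mxE.
  by rewrite block_mxEdr.
case: (split_ordP k) => k' ->.
  have := psd_entry_le1 P D (rshift 1 k') (lshift n 0).
  by rewrite block_mxEdl !mxE.
case/mxvec_indexP: k' => i j.
have := psd_entry_le1 P D (rshift 1 i) (rshift 1 j).
by rewrite block_mxEdr !mxE.
Qed.

Lemma sdp_min_attained (R : realType) (n : nat) (c : 'cV[R]_n)
    (F : 'M[R]_n) :
  exists2 p, sdp_feasible R n p &
    sdp_min c F = sdp_obj c F p /\
    forall q, sdp_feasible R n q -> sdp_obj c F p <= sdp_obj c F q.
Proof.
have [p0 P0] := sdp_feasible_nonempty R n.
have [||v vS vm] := @compact_EVT_min _ R (fun v => sdp_obj c F (sdp_point v))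
  (@sdp_point R n @^-1` sdp_feasible R n) _ (@sdp_feasible_compact R n).
- by exists (row_mx p0.1^T (mxvec p0.2)); rewrite /= sdp_pointK.
- by apply: continuous_subspaceT => w; exact: sdp_obj_continuous.
have vm' q : sdp_feasible R n q ->
    sdp_obj c F (sdp_point v) <= sdp_obj c F q.
  move=> Sq; rewrite -[q]sdp_pointK; apply: vm.
  by rewrite inE /= sdp_pointK.
have vS' := set_mem vS.
by exists (sdp_point v) => //; split=> //; apply: inf_min.
Qed.

Lemma sdp_max_attained (R : realType) (n : nat) (c : 'cV[R]_n)
    (F : 'M[R]_n) :
  exists2 p, sdp_feasible R n p &
    sdp_max c F = sdp_obj c F p /\
    forall q, sdp_feasible R n q -> sdp_obj c F q <= sdp_obj c F p.
Proof.
have [p0 P0] := sdp_feasible_nonempty R n.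
have [||v vS vm] := @compact_EVT_max _ R (fun v => sdp_obj c F (sdp_point v))
  (@sdp_point R n @^-1` sdp_feasible R n) _ (@sdp_feasible_compact R n).
- by exists (row_mx p0.1^T (mxvec p0.2)); rewrite /= sdp_pointK.
- by apply: continuous_subspaceT => w; exact: sdp_obj_continuous.
have vm' q : sdp_feasible R n q ->
    sdp_obj c F q <= sdp_obj c F (sdp_point v).
  move=> Sq; rewrite -[q]sdp_pointK; apply: vm.
  by rewrite inE /= sdp_pointK.
have vS' := set_mem vS.
by exists (sdp_point v) => //; split=> //; apply: sup_max.
Qed.

(* Main.v *)
Require Import Defs.
From mathcomp Require Import all_boot all_order all_algebra.
From mathcomp Require Import all_classical all_reals all_analysis.
From mathcomp Require Import lra.

Set Implicit Arguments.
Unset Strict Implicit.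
Unset Printing Implicit Defensive.

Import Order.TTheory GRing.Theory Num.Theory.
Local Open Scope ring_scope.

(** Write [f x] for [dot c x + qform F x].

    The constant [rho c F] bounds [`|f x|] at every vertex [x] of the hypercube,
    because the rank-one pair [(x, x *m x^T)] is feasible for both semidefinite
    programs and has objective value [f x] ([vertex_objective_le_rho]).

    The quadratic form [Q] is even, so its value at a vertex [(x, x0)] equals its
    value at [(x0 *: x, 1)].  Minimizing [Q] over the larger hypercube therefore
    amounts to minimizing [f z + (2 * rho + 1) * |A z - b|^2] over the
    vertices [z] ([penalized_form_vertex]).  At a feasible [z] the penalty
    vanishes and the value is [f z <= rho].  At an infeasible [z] the residual
    [A z - b] is a nonzero integer vector, so its squared norm is at least 1
    and the value is at least [- rho + (2 * rho + 1) = rho + 1]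
    ([infeasible_residual_ge1]).

    Hence [rho] separates the values of [Q] at feasible points from those at
    infeasible points: as soon as a feasible point exists, only feasible points
    can minimize [Q], and if none exists all values exceed [rho]. *)

Lemma qform_rank1 (R : realType) (n : nat) (w v : 'cV[R]_n) :
  qform (w *m w^T) v = dot w v ^+ 2.
Proof.
rewrite /qform /dot mulmxA -mulmxA mxE big_ord1 expr2; congr (_ * _).
by rewrite -[v^T *m w]trmxK mxE trmx_mul trmxK.
Qed.

Lemma psd_rank1 (R : realType) (n : nat) (w : 'cV[R]_n) : psd (w *m w^T).
Proof.
split; first by rewrite trmx_mul trmxK.
by move=> v; rewrite qform_rank1 sqr_ge0.
Qed.

Lemma vertex_sqr (R : realType) (n : nat) (x : 'cV[R]_n) (i : 'I_n) :
  hypercube R n x -> x i 0 ^+ 2 = 1.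
Proof. by move=> /(_ i)[] ->; rewrite ?sqrrN expr1n. Qed.

(** The bordered matrix of this pair is the Gram matrix of the single vector
    [col_mx 1 x], hence positive semidefinite. *)
Lemma vertex_sdp_feasible (R : realType) (n : nat) (x : 'cV[R]_n) :
  hypercube R n x -> sdp_feasible R n (x, x *m x^T).
Proof.
move=> Hx; split=> /=.
- by rewrite trmx_mul trmxK.
- have := psd_rank1 (col_mx 1%:M x).
  by rewrite tr_col_mx mul_col_row trmx1 !mul1mx mulmx1.
- by move=> i; rewrite mxE big_ord1 mxE -expr2 vertex_sqr.
Qed.

Lemma sdp_obj_rank1 (R : realType) (n : nat) (c : 'cV[R]_n) (F : 'M[R]_n)
    (x : 'cV[R]_n) :
  sdp_obj c F (x, x *m x^T) = dot c x + qform F x.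
Proof.
rewrite /sdp_obj /qform /=; congr (_ + _).
by rewrite -mulmxA mxtrace_mulC /mxtrace big_ord1.
Qed.

Lemma vertex_objective_le_rho (R : realType) (n : nat) (c : 'cV[R]_n)
    (F : 'M[R]_n) (x : 'cV[R]_n) :
  hypercube R n x -> `|dot c x + qform F x| <= rho c F.
Proof.
move=> /vertex_sdp_feasible Sx; rewrite -sdp_obj_rank1.
have [p _ [minE /(_ _ Sx)]] := sdp_min_attained c F.
have [q _ [maxE /(_ _ Sx)]] := sdp_max_attained c F.
rewrite -minE -maxE /rho => obj_le obj_ge.
(* A nonnegative value is bounded by the maximum, a negative one by the
   minimum. *)
rewrite le_max !ler_norml; case: (lerP 0 (sdp_obj c F (x, x *m x^T))) => s.
  apply/orP; right; apply/andP; split.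
    by apply: le_trans s; rewrite oppr_le0.
  exact: le_trans obj_le (ler_norm _).
apply/orP; left; apply/andP; split; last by apply: le_trans (ltW s) _.
by apply: le_trans obj_ge; rewrite lerNl -normrN ler_norm.
Qed.

Lemma enorm_sqr (R : realType) (n : nat) (v : 'cV[R]_n) :
  enorm v ^+ 2 = \sum_i v i 0 ^+ 2.
Proof. by rewrite sqr_sqrtr // sumr_ge0 // => i _; rewrite sqr_ge0. Qed.

(** A nonzero integer has square at least 1, so an integral residual that does
    not vanish cannot be small. *)
Lemma infeasible_residual_ge1 (R : realType) (m n : nat) (A : 'M[int]_(m, n))
    (b : 'cV[int]_m) (z : 'cV[R]_n) :
  hypercube R n z -> map_mx intr A *m z != map_mx intr b ->
  1 <= enorm (map_mx intr A *m z - map_mx intr b) ^+ 2.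
Proof.
move=> Hz; rewrite -subr_eq0; set r := _ - _ => r0.
have rint i : r i 0 \is a Num.int.
  rewrite !mxE rpredB ?intr_int //; apply: rpred_sum => j _.
  by rewrite mxE rpredM ?intr_int //; case: (Hz j) => ->; rewrite ?rpredN rpred1.
have [i ri] : exists i, r i 0 != 0.
  apply/existsP; apply: contraNT r0 => /existsPn r_eq0; apply/eqP/matrixP=> i j.
  by rewrite ord1 [in RHS]mxE; apply/eqP; have := r_eq0 i; rewrite negbK.
rewrite enorm_sqr (bigD1 i) //=.
apply: le_trans (_ : r i 0 ^+ 2 <= _); last first.
  by rewrite lerDl sumr_ge0 // => k _; rewrite sqr_ge0.
by rewrite -real_normK ?num_real // expr_ge1 // norm_intr_ge1.
Qed.

(** A quadratic form is even, so a vertex with last coordinate -1 may be negated.  Writing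
    [x0 *: x] covers both signs at once, since [x0 ^+ 2 = 1]. *)
Lemma penalized_form_vertex (R : realType) (m n : nat) (A : 'M[int]_(m, n))
    (b : 'cV[int]_m) (c : 'cV[R]_n) (F : 'M[R]_n) (y : 'cV[R]_(n + 1)) :
  hypercube R (n + 1) y ->
  let z := dsubmx y 0 0 *: usubmx y in
  hypercube R n z /\
  penalized_form A b c F y = dot c z + qform F z +
    (2 * rho c F + 1) * enorm (map_mx intr A *m z - map_mx intr b) ^+ 2.
Proof.
move=> Hy /=; rewrite /penalized_form.
have s1 : dsubmx y 0 0 = 1 \/ dsubmx y 0 0 = -1 by rewrite mxE.
split=> [i|].
  by rewrite mxE [usubmx y i 0]mxE; case: s1 => ->;
     case: (Hy (lshift 1 i)) => ->; rewrite ?mul1r ?mulN1r ?opprK; auto.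
have s2 : dsubmx y 0 0 ^+ 2 = 1 by rewrite mxE vertex_sqr.
move: (dsubmx y 0 0) (usubmx y) s2 {s1} => s x s2.
have dotZ : dot c (s *: x) = s * dot c x by rewrite /dot -scalemxAr mxE.
have qformZ : qform F (s *: x) = qform F x.
  have trZ : (s *: x)^T = s *: x^T by apply/matrixP=> i j; rewrite !mxE.
  by rewrite /qform trZ -scalemxAr -!scalemxAl scalerA -expr2 s2 scale1r.
rewrite dotZ qformZ; congr (_ + _ * _).
have -> : map_mx intr A *m (s *: x) - map_mx intr b =
    s *: (map_mx intr A *m x - s *: map_mx intr b).
  by rewrite scalerBr scalerA -expr2 s2 scale1r -scalemxAr.
rewrite !enorm_sqr; apply: eq_bigr => i _.
by rewrite [in RHS]mxE exprMn s2 mul1r.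
Qed.

Lemma penalized_form_feasible (R : realType) (m n : nat) (A : 'M[int]_(m, n))
    (b : 'cV[int]_m) (c : 'cV[R]_n) (F : 'M[R]_n) (x : 'cV[R]_n) :
  feasible R A b x ->
  hypercube R (n + 1) (col_mx x 1%:M) /\
  penalized_form A b c F (col_mx x 1%:M) = dot c x + qform F x.
Proof.
move=> [Ax Hx].
have Hy : hypercube R (n + 1) (col_mx x 1%:M).
  move=> i; case: (split_ordP i) => j ->; first by rewrite col_mxEu.
  by rewrite col_mxEd ord1 mxE; left.
split=> //; have [_ ->] := penalized_form_vertex A b c F Hy.
rewrite col_mxKd col_mxKu mxE scale1r Ax subrr enorm_sqr big1 ?mulr0 ?addr0 //.
by move=> i _; rewrite mxE expr0n.
Qed.

(** With the multiplier [2 * rho + 1], a violated constraint costs more than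
    the whole range [[- rho, rho]] of the objective. *)
Lemma penalized_form_dichotomy (R : realType) (m n : nat) (A : 'M[int]_(m, n))
    (b : 'cV[int]_m) (c : 'cV[R]_n) (F : 'M[R]_n) (y : 'cV[R]_(n + 1)) :
  hypercube R (n + 1) y ->
  (exists2 z, feasible R A b z &
     penalized_form A b c F y = dot c z + qform F z) \/
  rho c F < penalized_form A b c F y.
Proof.
move=> /(penalized_form_vertex A b c F); set z := _ *: _ => -[Hz ->].
have [Az|nAz] := eqVneq (map_mx intr A *m z) (map_mx intr b).
  left; exists z => //; rewrite Az subrr enorm_sqr big1 ?mulr0 ?addr0 //.
  by move=> i _; rewrite mxE expr0n.
right; have := infeasible_residual_ge1 Hz nAz.
have := vertex_objective_le_rho c F Hz.
rewrite ler_norml => /andP[lo hi]; set e := _ ^+ 2; nra.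
Qed.

Theorem theorem2p2 (R : realType) (m n : nat) (hm : (1 <= m)%N) (hn : (1 <= n)%N)
    (A : 'M[int]_(m, n)) (b : 'cV[int]_m) (c : 'cV[R]_n) (F : 'M[R]_n)
    (hF : F = F^T) :
  let Q := penalized_form A b c F in
  let theta := maxcut_value Q in
  ((fstar A b c F < +oo)%E -> fstar A b c F = theta%:E) /\
  (fstar A b c F = +oo%E <-> rho c F < theta).
Proof.
move=> Q theta.
have [y Hy [thetaE ymin]] := maxcut_value_attained Q.
have theta_le x : feasible R A b x -> theta <= dot c x + qform F x.
  move=> /(penalized_form_feasible c F)[Hx <-].
  by rewrite /theta thetaE; exact: ymin.
have theta_le_rho x : feasible R A b x -> theta <= rho c F.
  move=> fx; apply: le_trans (theta_le x fx) (le_trans (ler_norm _) _).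
  by apply: vertex_objective_le_rho; case: fx.
have [ne|empty] := pselect (feasible R A b !=set0)%classic; last first.
  have feas0 : feasible R A b = set0.
    by apply/seteqP; split=> // x fx; apply: empty; exists x.
  have foo : fstar A b c F = +oo%E by rewrite /fstar feas0 image_set0 ereal_inf0.
  split; first by rewrite foo ltxx.
  split=> // _; rewrite /theta thetaE.
  have [[z fz _]|//] := penalized_form_dichotomy A b c F Hy.
  by case: empty; exists z.
have [x fx [fE xmin]] := fstar_attained c F ne.
have le_rho := theta_le_rho x fx.
split=> [_|]; last first.
  by rewrite fE; split=> [//|/lt_le_trans/(_ le_rho)]; rewrite ltxx.
rewrite fE; congr (_%:E); apply/eqP; rewrite eq_le theta_le // andbT.
rewrite /theta thetaE in le_rho *.
have [[z fz Qz]|] := penalized_form_dichotomy A b c F Hy.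
  by rewrite [Q y]Qz; exact: xmin.
by move=> /lt_le_trans/(_ le_rho); rewrite ltxx.
Qed.
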